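(* Let $V$ be a finite set with $v=|V|\ge1$ and let $H$ be a finite set with $h=|H|$. If $$h\ \ge\ U(v,v):=\sum_{j=2}^vD(v,j),$$ then every probability distribution on $\{0,1\}^V$ can be approximated arbitrarily well by distributions from $\mathrm{RBM}_{V,H}$. Here $D(v,j)\le\frac{1+\log(v-j+1)}{v-j+1}\binom{v}{j}$ and $D(v,j)\le\binom{v-1}{j-1}$ for $0<j\le v$. In particular, the approximation conclusion holds whenever $h\ge2^{v-1}-1$, or ($v\ge2$ and) $$h\ \ge\ \frac{2(\log(v-1)+1)}{v+1}\big(2^v-(v+1)-1\big)+1 .$$
   Context: $\log$ denotes the natural logarithm. Restricted Boltzmann machine: $\mathrm{RBM}_{V,H}$ is the set of probability distributions on $\{0,1\}^V$ of the form $p(x)=\frac1Z\exp(F(x))$ with $$F(x)=\sum_{i\in V}b_ix_i+\sum_{j\in H}\log\Big(1+\exp\Big(\sum_{i\in V}w_{ji}x_i+c_j\Big)\Big),$$ where $b_i,w_{ji},c_j\in\mathbb{R}$ are arbitrary and $Z$ is the normalizing constant. A distribution $p$ can be approximated arbitrarily well by distributions from a model $\mathcal{M}$ if for every $\epsilon>0$ there is $q\in\mathcal{M}$ with $\max_x|p(x)-q(x)|\le\epsilon$. A star tuple is a set of the form $\{B\cup\{j\}: j\in B'\}$ with $B,B'\subseteq V$ and $B\cap B'=\emptyset$. $D(v,j)$ is the smallest number of star tuples whose union contains $\binom{V}{j}=\{\Lambda\subseteq V:|\Lambda|=j\}$. Empty sums are $0$. *)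

(* Defs.v *)
From HB Require Import structures.
From mathcomp Require Import all_boot all_order all_algebra.
From mathcomp Require Import all_classical all_reals all_analysis.

Set Implicit Arguments.
Unset Strict Implicit.
Unset Printing Implicit Defensive.

Import Order.TTheory GRing.Theory Num.Theory.
Local Open Scope ring_scope.

Notation state V := {ffun V -> bool}.

Definition is_distribution (R : realType) (X : finType) (p : {ffun X -> R}) :
  Prop := (forall x, 0 <= p x) /\ \sum_x p x = 1.

Definition rbm_F (R : realType) (V H : finType)
    (b : V -> R) (w : H -> V -> R) (c : H -> R) (x : state V) : R :=
  \sum_(i : V) b i * (x i)%:R
  + \sum_(j : H) ln (1 + expR (\sum_(i : V) w j i * (x i)%:R + c j)).

Definition rbm_Z (R : realType) (V H : finType)
    (b : V -> R) (w : H -> V -> R) (c : H -> R) : R :=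
  \sum_(x : state V) expR (rbm_F b w c x).

Definition RBM (R : realType) (V H : finType) : set {ffun state V -> R} :=
  fun p : {ffun state V -> R} =>
    exists (b : V -> R) (w : H -> V -> R) (c : H -> R),
      p = [ffun x => (rbm_Z b w c)^-1 * expR (rbm_F b w c x)].

(* The neutral element 0 of the maximum is harmless: all terms are >= 0. *)
Definition approximable (R : realType) (X : finType) (M : set {ffun X -> R})
    (p : {ffun X -> R}) : Prop :=
  forall eps : R, 0 < eps ->
    exists2 q, M q & \big[Num.max/0]_(x : X) `|p x - q x| <= eps.

Definition star_tuple (V : finType) (S : {set {set V}}) : bool :=
  [exists B : {set V}, exists B' : {set V},
     [disjoint B & B'] && (S == [set B :|: [set j] | j in B'])].

Definition star_cover (V : finType) (j : nat) (C : {set {set {set V}}}) : bool :=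
  [forall S in C, star_tuple S]
  && ([set L : {set V} | #|L| == j] \subset finset.cover C).

(* The minimum is taken over families covering the j-subsets. The family of
   all star tuples is the starting point of the search; it is such a cover
   exactly when j > 0 (the empty set lies in no star tuple), so the value at
   j = 0 is junk. By transport along bijections D V j depends only on #|V|
   and j. *)
Definition D (V : finType) (j : nat) : nat :=
  #|[arg min_(C < [set S : {set {set V}} | star_tuple S] | star_cover j C) #|C| ]|.

Lemma star_cover_all (V : finType) (j : nat) :
  (0 < j)%N -> star_cover j [set S : {set {set V}} | star_tuple S].
Proof.
move=> j0; apply/andP; split.
  by apply/forallP => S; apply/implyP; rewrite inE.
apply/fintype.subsetP => L; rewrite inE => /eqP cL.
have /card_gt0P[a aL] : (0 < #|L|)%N by rewrite cL.
apply/finset.bigcupP; exists [set (L :\ a) :|: [set i] | i in [set a]].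
  rewrite inE; apply/existsP; exists (L :\ a); apply/existsP; exists [set a].
  by rewrite eqxx andbT disjoint_sym disjoints1 !inE eqxx.
by apply/imsetP; exists a; rewrite ?inE // finset.setUC finset.setD1K.
Qed.

Lemma D_is_min (V : finType) (j : nat) : (0 < j)%N ->
  (exists2 C : {set {set {set V}}}, star_cover j C & #|C| = D V j) /\
  (forall C : {set {set {set V}}}, star_cover j C -> (D V j <= #|C|)%N).
Proof.
move=> j0; rewrite /D; case: arg_minnP; first exact: star_cover_all.
by move=> C hC hmin; split=> //; exists C.
Qed.

Definition U (V : finType) (k : nat) : nat := (\sum_(2 <= j < k.+1) D V j)%N.

(* Main.v *)
Require Import Defs.
From HB Require Import structures.
From mathcomp Require Import all_boot all_order all_algebra.
From mathcomp Require Import all_classical all_reals all_analysis.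
From mathcomp Require Import ring lra.
Import Order.TTheory GRing.Theory Num.Theory.
Local Open Scope ring_scope.

(** A distribution with full support is proportional to exp f, so it suffices to
    approximate every function f on {0,1}^V, up to an additive constant, by an
    energy: a linear form plus one softplus s |-> ln (1 + e^s) per hidden unit.
    Write f as a multilinear polynomial, a combination of the monomials x^A.

    The softplus is close to 0 far to the left and to the identity far to the
    right.  Hence one unit with a very large weight on each i in B and a bias that
    makes it inactive unless x^B = 1 approximates x^B * (c + a.x) for any weights a
    and any sufficiently large c (star_unit): the unit gets the coefficients of all
    monomials of a star tuple with centre B right, creates no monomial of
    higher degree than these, and disturbs only the coefficient of x^B, which
    has lower degree.  So the polynomial can be treated from the top degree
    downwards, with D V j units for the degree j monomials; the disturbance is
    absorbed by the lower degrees, the degree one part by the biases of the visible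
    variables, and the constant by the normalisation (approx_supported_star,
    approx_supported_degree, RBM_approx_pos).  Zero probabilities are reached by
    mixing with the uniform distribution.

    Covers by star tuples are obtained from families of (j-1)-sets such that each
    j-set contains a member of the family (D_le_subsets).  The (j-1)-subsets of the
    complement of one vertex form such a family, which gives the binomial bound.
    For the logarithmic bound take each (j-1)-set with probability q, and add one
    (j-1)-subset of every j-set left uncovered (D_le_alteration); with
    v = #|V| and a = v - j + 1, the choice q = ln a / j gives the claim.  The two explicit bounds
    on the number of hidden units are the sums over j of these estimates. *)

Set Implicit Arguments.
Unset Strict Implicit.
Unset Printing Implicit Defensive.

(** * Energies and star tuples *)

Section Softplus.
Context {R : realType}.

Definition softplus (s : R) : R := ln (1 + expR s).

Lemma softplus_ge0 s : 0 <= softplus s.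
Proof. by apply: ln_ge0; rewrite lerDl expR_ge0. Qed.

Lemma softplus_le_expR s : softplus s <= expR s.
Proof. by apply: le_ln1Dx; rewrite (lt_le_trans _ (expR_ge0 s)) ?oppr_lt0 ?ltr01. Qed.

(** Symmetry that reduces the behaviour at +oo to the decay at -oo. *)
Lemma softplusN s : softplus s = s + softplus (- s).
Proof.
have p t : (1 + expR t : R) \is Num.pos by rewrite posrE addr_gt0 ?expR_gt0.
rewrite /softplus -{2}[s]expRK -lnM ?posrE ?expR_gt0 ?p //.
by rewrite mulrDr mulr1 -expRD subrr expR0 addrC.
Qed.

End Softplus.

Section HiddenUnits.
Context {R : realType} {V : finType}.
Implicit Types (x : state V) (A B : {set V}) (f : state V -> R).

Definition dot (w : V -> R) x : R := \sum_i w i * (x i)%:R.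

(** Hidden units form a sequence, each given by its weights and bias, so that
    they can be added one at a time. *)
Definition energy (b : V -> R) (us : seq ((V -> R) * R)) x : R :=
  dot b x + \sum_(u <- us) softplus (dot u.1 x + u.2).

(** The constant k accounts for the normalisation of the distribution. *)
Definition energy_approx (m : nat) f : Prop :=
  forall eps : R, 0 < eps -> exists b us k,
    size us = m /\ forall x, `|energy b us x + k - f x| <= eps.

Definition monomial A x : R := (A \subset [set i | x i])%:R.

Lemma monomial_setU1 B i x : monomial (B :|: [set i]) x = monomial B x * (x i)%:R.
Proof.
by rewrite /monomial finset.subUset finset.sub1set inE -natrM mulnb.
Qed.

(** If B is contained in the support of x, the argument of the softplus is
    c + dot a x, which c makes so large that softplus is the identity up to eps;
    otherwise at least one weight om is missing and makes the argument so negative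
    that softplus vanishes up to eps. *)
Lemma star_unit (B : {set V}) (a : V -> R) (eps : R) : 0 < eps ->
  exists w c0 c, forall x,
    `|softplus (dot w x + c0) - monomial B x * (c + dot a x)| <= eps.
Proof.
move=> eps0; pose t := - ln eps; pose S := \sum_i `|a i|.
have ht : expR (- t) = eps by rewrite opprK lnK.
have S0 : 0 <= S by apply: sumr_ge0.
have hS x : `|dot a x| <= S.
  rewrite (le_trans (ler_norm_sum _ _ _)) // ler_sum // => i _.
  by case: (x i); rewrite ?mulr1 // mulr0 normr0.
pose c := S + t; pose om := `|c + S + t|.
(* The weights om collected on B cancel the part - om * #|B| of the bias only if
   B lies in the support of x; each missing element leaves a term - om. *)
exists (fun i => om * (i \in B)%:R + a i), (c - om * #|B|%:R), c => x.
have -> : dot (fun i => om * (i \in B)%:R + a i) x + (c - om * #|B|%:R) =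
    c + dot a x - om * (#|B :\: [set i | x i]|)%:R.
  have -> : dot (fun i => om * (i \in B)%:R + a i) x =
     om * (#|B :&: [set i | x i]|)%:R + dot a x.
    rewrite /dot -sum1_card natr_sum mulr_sumr.
    rewrite [X in _ = X + _](big_mkcond) /= -big_split /=.
    apply: eq_bigr => i _; rewrite !inE.
    by case: (i \in B); case: (x i); rewrite /=; ring.
  by rewrite -(cardsID [set i | x i] B) natrD; ring.
have [/andP[h1 h2]] : (- S <= dot a x) && (dot a x <= S) by rewrite -ler_norml.
rewrite /monomial; case: (boolP (_ \subset _)) => hB.
  have /eqP -> : #|B :\: [set i | x i]| == 0%N by rewrite cards_eq0 finset.setD_eq0.
  rewrite mulr0 subr0 mul1r softplusN addrAC subrr add0r.
  rewrite ger0_norm ?softplus_ge0 // (le_trans (softplus_le_expR _)) //.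
  by rewrite -ht ler_expR /c; lra.
rewrite mul0r subr0 ger0_norm ?softplus_ge0 // (le_trans (softplus_le_expR _)) //.
rewrite -ht ler_expR.
have h3 : 1 <= (#|B :\: [set i | x i]|)%:R :> R.
  by rewrite ler1n card_gt0 finset.setD_eq0.
have h4 : om <= om * (#|B :\: [set i | x i]|)%:R by rewrite ler_peMr // normr_ge0.
have h5 : c + S + t <= om by apply: ler_norm.
by lra.
Qed.

(** The size of c in star_unit depends on the precision, so that f has to be
    approximable after subtraction of any multiple of the monomial of B. *)
Lemma energy_approx_star m f B a :
  (forall c, energy_approx m (fun x => f x - c * monomial B x)) ->
  energy_approx m.+1 (fun x => f x + monomial B x * dot a x).
Proof.
move=> hf eps eps0; have e2 : 0 < eps / 2 by lra.
have [w [c0 [c hw]]] := star_unit B a e2.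
have [b [us [k [hs hn]]]] := hf c _ e2.
exists b, ((w, c0) :: us), k; split; first by rewrite /= hs.
move=> x; rewrite /energy big_cons /=.
have := hw x; have := hn x; rewrite /energy !ler_norml => /andP[? ?] /andP[? ?].
by apply/andP; split; lra.
Qed.

Lemma energy_approx_eq m f g : f =1 g -> energy_approx m f -> energy_approx m g.
Proof. by move=> /funext ->. Qed.

Lemma energy_approxS m f : energy_approx m f -> energy_approx m.+1 f.
Proof.
move=> hf eps eps0; have [b [us [k [hs hn]]]] := hf _ eps0.
exists b, ((fun=> 0, 0) :: us), (k - softplus 0); split; first by rewrite /= hs.
move=> x; rewrite /energy big_cons /=.
have -> : dot (fun=> 0) x = 0 by rewrite /dot big1 // => i _; rewrite mul0r.
by rewrite addr0; move: (hn x); rewrite /energy; congr (`| _ | <= _); ring.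
Qed.

Lemma energy_approx_leq m n f : (m <= n)%N -> energy_approx m f -> energy_approx n f.
Proof.
move=> /subnK <- hf; elim: (n - m)%N => [//|k IH].
by rewrite addSn; apply: energy_approxS.
Qed.

Definition multilinear (J : {set V} -> R) x : R := \sum_A J A * monomial A x.

(** The induction enlarges the set E of monomials that m units can handle, with
    all coefficients on E arbitrary at the same time. *)
Definition approx_supported m (E : {set {set V}}) : Prop :=
  forall J, (forall A, A \notin E -> J A = 0) -> energy_approx m (multilinear J).

Lemma approx_supported_sub m (E E' : {set {set V}}) :
  E' \subset E -> approx_supported m E -> approx_supported m E'.
Proof.
move=> sE hE J hJ; apply: hE => A nA; apply: hJ.
by apply: contra nA; apply: (fintype.subsetP sE).
Qed.

(** The visible biases realise all affine functions without hidden units. *)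
Lemma approx_supported_affine :
  approx_supported 0 [set A : {set V} | (#|A| <= 1)%N].
Proof.
move=> J hJ eps eps0; exists (fun i => J [set i]), [::], (J finset.set0).
split=> // x; rewrite /energy big_nil addr0.
suff -> : multilinear J x = dot (fun i => J [set i]) x + J finset.set0.
  by rewrite subrr normr0 ltW.
rewrite /multilinear (bigD1 finset.set0) //= {1}/monomial finset.sub0set mulr1 addrC.
congr (_ + _).
rewrite (bigID (fun A : {set V} => #|A| == 1%N)) /= [X in _ + X]big1 ?addr0; last first.
  move=> A /andP[A0 A1]; rewrite hJ ?mul0r // inE.
  by rewrite -ltnNge ltn_neqAle eq_sym A1 card_gt0.
rewrite (eq_bigl (fun A : {set V} => A \in [set [set i] | i : V])); last first.
  move=> A; apply/andP/imsetP => [[_ /cards1P[i ->]]|[i _ ->]]; first by exists i.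
  by rewrite cards1 -cards_eq0 cards1.
rewrite big_imset /=; last by move=> i j _ _; apply: finset.set1_inj.
apply: eq_bigr => i _; rewrite -[X in monomial X x]finset.set0U monomial_setU1.
by rewrite /monomial finset.sub0set mul1r.
Qed.

(** Monomials of the star tuple that already lie in E are left to the m earlier
    units; the new unit takes the others, at the price of a multiple of the
    monomial of B, which is in E. *)
Lemma approx_supported_star m (E : {set {set V}}) (B B' : {set V}) :
  [disjoint B & B'] -> B \in E -> approx_supported m E ->
  approx_supported m.+1 (E :|: [set B :|: [set j] | j in B']).
Proof.
move=> dB BE hE J hJ.
pose J1 A := if A \in E then J A else 0.
pose a i := if (i \in B') && (B :|: [set i] \notin E) then J (B :|: [set i]) else 0.
apply: (@energy_approx_eq _ (fun x => multilinear J1 x + monomial B x * dot a x)).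
  move=> x; rewrite /multilinear [in RHS](bigID (fun A => A \in E)) /=; congr (_ + _).
    rewrite [RHS]big_mkcond; apply: eq_bigr => A _ /=; rewrite /J1.
    by case: ifP => // _; rewrite mul0r.
  rewrite (bigID (fun A => A \in [set B :|: [set j] | j in B'])) /=.
  rewrite [X in _ = _ + X]big1 ?addr0; last first.
    by move=> A /andP[h1 h2]; rewrite hJ ?mul0r // inE (negbTE h1) (negbTE h2).
  rewrite (eq_bigl (fun A => (A \in [set B :|: [set j] | j in B']) && (A \notin E)));
    last by move=> A; rewrite andbC.
  rewrite big_mkcondr /=.
  rewrite big_imset /=; last first.
    move=> i j iB jB /setP /(_ i); rewrite !inE eqxx orbT.
    have -> : i \in B = false by apply/negbTE; rewrite (disjointFl dB).
    by move=> /esym/eqP.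
  rewrite /dot mulr_sumr [RHS]big_mkcond /=; apply: eq_bigr => i _.
  rewrite /a monomial_setU1; case: (i \in B'); case: (_ \notin _) => //=; ring.
apply: energy_approx_star => c.
apply: (@energy_approx_eq _ (multilinear (fun A => J1 A - c * (A == B)%:R))).
  move=> x; rewrite /multilinear.
  under eq_bigr do rewrite mulrBl.
  rewrite sumrB; congr (_ - _).
  rewrite (bigD1 B) //= eqxx mulr1 big1 ?addr0 // => A /negbTE ->.
  by rewrite mulr0 mul0r.
apply: hE => A AE; rewrite /J1 (negbTE AE).
have /negbTE -> : A != B by apply: contraNneq AE => ->.
by rewrite mulr0 subr0.
Qed.

(** Only the sets of cardinality j in each star tuple matter; if there are any,
    the centre of the tuple has cardinality j - 1 and hence lies in E. *)
Lemma approx_supported_cover m (j : nat) (E : {set {set V}}) (s : seq {set {set V}}) :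
  all (@star_tuple V) s ->
  [set A : {set V} | (#|A| < j)%N] \subset E -> approx_supported m E ->
  approx_supported (size s + m)
    (E :|: [set A : {set V} | (#|A| == j) && has (fun S : {set {set V}} => A \in S) s]).
Proof.
elim: s => [|S s IH] /=.
  move=> _ _; apply: approx_supported_sub.
  by apply/fintype.subsetP => A; rewrite !inE andbF orbF.
move=> /andP[/existsP[B /existsP[B' /andP[dB /eqP eS]]] hs] sE hE.
have {IH}:= IH hs sE hE.
set E1 := _ :|: _ => h1.
have [cB|cB] := eqVneq #|B|.+1 j.
  have BE : B \in E1.
    by rewrite inE (fintype.subsetP sE) // inE -cB.
  have := approx_supported_star dB BE h1; rewrite -eS.
  apply: approx_supported_sub.
  apply/fintype.subsetP => A; rewrite !inE.
  by case: (A \in E); case: (A \in S); case: (#|A| == j); rewrite //= ?orbF ?orbT.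
rewrite addSn; move=> J hJ; apply: energy_approxS; apply: h1 => A nA; apply: hJ.
apply: contra nA; rewrite !inE; case: (A \in E) => //=.
case: eqP => //= cA /orP[|//]; rewrite eS => /imsetP[i iB eA].
case/negP: cB; rewrite -cA eA finset.setUC cardsU1.
by rewrite (disjointFl dB) // add1n.
Qed.

Lemma approx_supported_degree (j : nat) : (1 <= j)%N ->
  approx_supported (U V j) [set A : {set V} | (#|A| <= j)%N].
Proof.
elim: j => [//|[|j] IH] _.
  by rewrite /U big_geq //; exact: approx_supported_affine.
have [[C /andP[hC cC] eC] _] := D_is_min V (ltn0Sn j.+1).
rewrite /U big_nat_recr //= addnC -eC cardE.
have := @approx_supported_cover _ j.+2 _ (enum C) _ _ (IH isT).
move=> /(_ _ _)/wrap[].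
- by apply/allP => S; rewrite mem_enum => SC; move/forall_inP: hC; apply.
- by apply/fintype.subsetP => A; rewrite !inE.
apply: approx_supported_sub; apply/fintype.subsetP => A; rewrite !inE.
rewrite leq_eqVlt => /orP[cA|]; last by rewrite ltnS => ->.
apply/orP; right; rewrite cA /=; apply/hasP.
have /bigcupP[S SC AS] : A \in finset.cover C by apply: (fintype.subsetP cC); rewrite inE.
by exists S; rewrite ?mem_enum.
Qed.

(** The coefficients are found by recursion on the degree: the value of f at the
    indicator of A determines the coefficient of A from those of its proper
    subsets. *)
Lemma multilinear_exists f : exists J, f =1 multilinear J.
Proof.
(* The bound on the cardinality is there for the induction. *)
suff [J hJ] : exists J : {set V} -> R, forall A : {set V}, (#|A| < #|V|.+1)%N ->
    \sum_(L : {set V} | L \subset A) J L = f [ffun i => i \in A].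
  exists J => x; rewrite /multilinear.
  have -> : f x = f [ffun i => i \in [set i | x i]].
    by congr f; apply/ffunP => i; rewrite ffunE inE.
  rewrite -hJ ?ltnS ?max_card // big_mkcond; apply: eq_bigr => A _ /=.
  by rewrite /monomial; case: (_ \subset _); rewrite ?mulr1 ?mulr0.
elim: #|V|.+1 => [|n [J hJ]]; first by exists (fun=> 0).
exists (fun A => if (#|A| < n)%N then J A else
   f [ffun i => i \in A] - \sum_(L : {set V} | L \proper A) J L) => A.
rewrite ltnS leq_eqVlt => /orP[/eqP cA|cA]; last first.
  rewrite -hJ //; apply: eq_bigr => L /subset_leq_card cL.
  by rewrite (leq_ltn_trans cL cA).
rewrite (bigD1 A) //= cA ltnn -[RHS](subrK (\sum_(L : {set V} | L \proper A) J L)).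
congr (_ + _); apply: eq_big => [L|L].
  by rewrite finset.properEneq andbC.
by rewrite -cA andbC -finset.properEneq => /proper_card ->.
Qed.

Lemma energy_approx_all f : (1 <= #|V|)%N -> energy_approx (U V #|V|) f.
Proof.
move=> hV; have [J hJ] := multilinear_exists f.
apply: (energy_approx_eq (fsym hJ)); apply: (approx_supported_degree hV) => A.
by rewrite inE max_card.
Qed.

End HiddenUnits.

(** * From energies to distributions *)

Section Distributions.
Context {R : realType} {V H : finType}.
Implicit Types (p : {ffun state V -> R}).

Lemma energy_rbm_F b (us : seq ((V -> R) * R)) : size us = #|H| ->
  exists (w : H -> V -> R) c, energy b us =1 rbm_F b w c.
Proof.
move=> hs; pose u (j : H) := nth (fun=> 0, 0) us (enum_rank j).
exists (fun j => (u j).1), (fun j => (u j).2) => x.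
rewrite /energy /rbm_F; congr (_ + _).
rewrite (big_nth (fun=> 0, 0)) hs big_mkord.
by rewrite (reindex (@enum_rank H)) //; apply: onW_bij; apply: enum_rank_bij.
Qed.

(** If the energy is within d of ln p up to a constant, then the unnormalised
    weights are within a factor e^d of p, their sum is within the same factor of 1,
    and q is within a factor e^(2d) = 1 + eta of p. *)
Lemma RBM_approx_pos p :
  (forall f : state V -> R, energy_approx #|H| f) ->
  (forall x, 0 < p x) -> \sum_x p x = 1 ->
  forall eta : R, 0 < eta -> exists2 q, @RBM R V H q & forall x, `|p x - q x| <= eta.
Proof.
move=> hf p0 p1 eta eta0.
pose d := ln (1 + eta) / 2.
have d0 : 0 < d by rewrite divr_gt0 // ln_gt0 // ltrDl.
have [b [us [k [/(energy_rbm_F b) [w [c hw]] hn]]]] := hf (fun x => ln (p x)) d d0.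
exists [ffun x => (rbm_Z b w c)^-1 * expR (rbm_F b w c x)]; first by exists b, w, c.
pose g x := expR (rbm_F b w c x + k); pose G := \sum_x g x.
pose e := expR d.
have e0 : 0 < e by apply: expR_gt0.
have ee : e * e = 1 + eta.
  by rewrite -expRD /d -splitr lnK // posrE addr_gt0.
have g0 x : 0 < g x by apply: expR_gt0.
have gp x : g x <= p x * e.
  have := hn x; rewrite hw ler_norml => /andP[_ h].
  by rewrite -[p x]lnK ?posrE // -expRD ler_expR; lra.
have pg x : p x <= g x * e.
  have := hn x; rewrite hw ler_norml => /andP[h _].
  by rewrite -[p x]lnK ?posrE // -expRD ler_expR; lra.
have Ge : G <= e by rewrite -[e]mul1r -p1 mulr_suml ler_sum.
have eG : 1 <= G * e by rewrite -p1 mulr_suml ler_sum.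
have G0 : 0 < G by rewrite -(pmulr_lgt0 _ e0) (lt_le_trans ltr01).
move=> x; rewrite ffunE.
have -> : (rbm_Z b w c)^-1 * expR (rbm_F b w c x) = g x / G.
  rewrite /G /g /rbm_Z; under [in RHS]eq_bigr do rewrite expRD.
  rewrite -mulr_suml expRD invfM.
  rewrite mulrC mulrACA -[LHS]mulr1; congr (_ * _).
  by rewrite mulfV // gt_eqF ?expR_gt0.
have gG : g x <= G.
  by rewrite /G (bigD1 x) //= lerDl sumr_ge0 // => y _; rewrite ltW.
have px1 : p x <= 1.
  by rewrite -p1 (bigD1 x) //= lerDl sumr_ge0 // => y _; rewrite ltW.
have q1 : g x / G <= 1 by rewrite ler_pdivrMr // mul1r.
have h1 : g x / G <= p x * (1 + eta).
  rewrite ler_pdivrMr // -ee (le_trans (gp x)) //.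
  rewrite -!mulrA ler_pM2l // mulrC -[leLHS]mul1r mulrC [_ * G]mulrC.
  by rewrite mulrC ler_pM2r // [_ * e]mulrC.
have h2 : p x <= g x / G * (1 + eta).
  rewrite -ee mulrAC ler_pdivlMr // (le_trans (ler_pM _ _ (pg x) Ge)) //.
  - by rewrite ltW.
  - by rewrite ltW.
  - by rewrite mulrA.
have h3 : 0 <= g x / G by rewrite divr_ge0 // ltW.
have h4 := p0 x.
by rewrite ler_norml; apply/andP; split; nra.
Qed.

(** Mixing with the uniform distribution makes p positive, so that it has a
    logarithm, at the cost of half the precision. *)
Lemma RBM_approximable p :
  (forall f : state V -> R, energy_approx #|H| f) ->
  is_distribution p -> approximable (@RBM R V H) p.
Proof.
move=> hf [p0 p1] eps eps0.
pose N : R := #|state V|%:R.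
have N0 : 0 < N by rewrite ltr0n; apply/card_gt0P; exists [ffun=> false].
pose t := Num.min (eps / 2) (1 / 2).
have t0 : 0 < t by rewrite lt_min; apply/andP; split; lra.
have te : t <= eps / 2 by rewrite ge_min lexx.
have t1 : t <= 1 / 2 by rewrite ge_min lexx orbT.
pose p' : {ffun state V -> R} := [ffun x => (1 - t) * p x + t / N].
have e2 : 0 < eps / 2 by lra.
have [] := @RBM_approx_pos p' hf _ _ _ e2.
- move=> x; rewrite ffunE ltr_wpDl ?divr_gt0 //.
  by rewrite mulr_ge0 // subr_ge0; lra.
- under eq_bigr do rewrite ffunE.
  rewrite big_split /= -mulr_sumr p1 sumr_const -mulr_natr -/N.
  by rewrite divfK ?gt_eqF // mulr1 subrK.
move=> q qM hq; exists q => //.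
apply: bigmax_le => [|x _]; first by rewrite ltW.
have px1 : p x <= 1 by rewrite -p1 (bigD1 x) //= lerDl sumr_ge0.
have i0 : 0 < N^-1 by rewrite invr_gt0.
have i1 : N^-1 <= 1.
  by rewrite invf_le1 // ler1n -(ltr0n R).
have := hq x; have := p0 x; rewrite ffunE !ler_norml => ? /andP[? ?].
by apply/andP; split; nra.
Qed.

End Distributions.

(** * Bounds on covers by star tuples *)

Section Covers.
Context {V : finType}.

(** A subset B of L with one element less is the centre of a star tuple that
    contains L: take all one-element extensions of B. *)
Lemma D_le_subsets (j : nat) (F : {set {set V}}) : (0 < j)%N ->
  (forall L : {set V}, #|L| = j -> exists2 B, B \in F & B \subset L /\ #|B| = j.-1) ->
  (D V j <= #|F|)%N.
Proof.
move=> j0 hF; pose star (B : {set V}) := [set B :|: [set i] | i in ~: B].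
apply: leq_trans (leq_imset_card star F).
have [_ +] := D_is_min V j0; apply.
apply/andP; split.
  apply/forall_inP => S /imsetP[B BF ->].
  apply/existsP; exists B; apply/existsP; exists (~: B).
  by rewrite eqxx andbT -finset.setI_eq0 finset.setICr.
apply/fintype.subsetP => L; rewrite inE => /eqP cL.
have [B BF [BL cB]] := hF L cL.
have /cards1P[i hi] : #|L :\: B| == 1%N.
  by rewrite cardsDS // cL cB -subn1 subKn.
apply/bigcupP; exists (star B); first by apply/imsetP; exists B.
apply/imsetP; exists i.
  have : i \in L :\: B by rewrite hi inE.
  by rewrite !inE => /andP[].
by rewrite -hi finset.setUC -{2}(finset.setIidPr BL) finset.setUC finset.setID.
Qed.

(** Every j-set has a (j-1)-subset avoiding a fixed vertex a: remove a if it is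
    there, any element otherwise. *)
Lemma D_le_bin (j : nat) : (0 < j <= #|V|)%N -> (D V j <= 'C(#|V| - 1, j - 1))%N.
Proof.
move=> /andP[j0 jV].
have /card_gt0P[a _] : (0 < #|V|)%N by apply: leq_trans jV.
rewrite !subn1 -(cardsC1 a) -cards_draws.
apply: D_le_subsets => // L cL.
have [b bL ab] : exists2 b, b \in L & (a \in L -> b = a).
  have [aL|aL] := boolP (a \in L); first by exists a.
  by have /card_gt0P[b bL] : (0 < #|L|)%N; [rewrite cL | exists b].
have cB : #|L :\ b| = j.-1 by rewrite -cL (cardsD1 b L) bL.
exists (L :\ b); last by split; rewrite // finset.subsetDl.
rewrite inE cB eqxx andbT; apply/fintype.subsetP => y; rewrite !inE.
by move=> /andP[yb yL]; apply: contraNneq yb => ya; rewrite -ya in ab; rewrite ab.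
Qed.

Lemma card_subsets_degree (j : nat) (L : {set V}) : (0 < j)%N -> #|L| = j ->
  count (fun B : {set V} => B \subset L) (enum [set B : {set V} | #|B| == j.-1]) = j.
Proof.
case: j => // j _ cL.
rewrite -size_filter -[RHS]binSn -[X in 'C(X, _)]cL -cards_draws [RHS]cardE.
apply/perm_size/uniq_perm; [by apply/filter_uniq/enum_uniq|exact: enum_uniq|].
move=> B.
by rewrite mem_filter !mem_enum !inE.
Qed.

End Covers.

Section Alteration.
Context {R : realType} {I T : eqType}.

(** The right-hand side is the expected value of the left-hand side when every
    element of s is selected independently with probability q, s' being the
    selected elements.  The proof is the method of conditional expectations: the
    bound for i :: s is the convex combination, with weights q and 1 - q, of the
    bounds after selecting i and after rejecting it, so one of the two choices
    keeps to it. *)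
Lemma alteration (r : I -> pred T) (q : R) (s : seq I) (E : seq T) :
  0 <= q <= 1 ->
  exists2 s', {subset s' <= s} &
    (size s' + count (fun x => ~~ has (r^~ x) s') E)%:R <=
    q * (size s)%:R + \sum_(x <- E) (1 - q) ^+ count (r^~ x) s.
Proof.
move=> /andP[q0 q1]; elim: s E => [|i s IH] E.
  exists [::] => //=; rewrite mulr0 add0r add0n count_predT.
  by rewrite big_const_seq count_predT iter_addr_0.
have [s1 sub1 h1] := IH E.
have [s2 sub2 h2] := IH [seq x <- E | ~~ r i x].
pose Phi := \sum_(x <- E | ~~ r i x) (1 - q) ^+ count (r^~ x) s.
pose Psi := \sum_(x <- E | r i x) (1 - q) ^+ count (r^~ x) s.
have hE : \sum_(x <- E) (1 - q) ^+ count (r^~ x) (i :: s) = Phi + (1 - q) * Psi.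
  rewrite (bigID (fun x => ~~ r i x)) /= mulr_sumr; congr (_ + _).
    by apply: eq_bigr => x /negbTE ->.
  by apply: eq_big => x; rewrite negbK // => ->; rewrite exprS.
have e1 : \sum_(x <- E) (1 - q) ^+ count (r^~ x) s = Phi + Psi.
  rewrite (bigID (fun x => ~~ r i x)) /=; congr (_ + _).
  by apply: eq_bigl => x; rewrite negbK.
rewrite big_filter -/Phi in h2; rewrite e1 in h1; rewrite hE.
have [le|lt] := leP (1 + (q * (size s)%:R + Phi))
    (q * (size (i :: s))%:R + (Phi + (1 - q) * Psi)).
  exists (i :: s2).
    by move=> y; rewrite !inE => /orP[->//|/sub2 ->]; rewrite orbT.
  apply: le_trans le; rewrite /= addSn -natr1 addrC lerD2l.
  apply: le_trans h2; rewrite ler_nat leq_add2l count_filter.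
  by apply: sub_count => x /=; rewrite negb_or andbC.
exists s1; first by move=> y /sub1; rewrite inE orbC => ->.
apply: le_trans h1 _.
have Psi0 : 0 <= Psi by apply: sumr_ge0 => x _; rewrite exprn_ge0 // subr_ge0.
(* Rejecting i is affordable because selecting it is not: that forces Psi < 1. *)
move: lt; rewrite /= -natr1 => lt.
have h : 0 < (1 - q) * (1 - Psi) by lra.
have Psi1 : Psi < 1 by rewrite ltNge; apply/negP => Psi1; nra.
have : 0 <= q * (1 - Psi) by rewrite mulr_ge0 // subr_ge0 ltW.
by lra.
Qed.

End Alteration.

(** * The logarithmic bound and the sums over all degrees *)

Section Bounds.
Context {R : realType} {V : finType}.

(** Select (j-1)-sets with probability q; every j-set has exactly j subsets of
    that cardinality and so is missed with probability (1 - q)^j. *)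
Lemma D_le_alteration (j : nat) (q : R) : (0 < j)%N -> 0 <= q <= 1 ->
  (D V j)%:R <= q * 'C(#|V|, j.-1)%:R + (1 - q) ^+ j * 'C(#|V|, j)%:R.
Proof.
move=> j0 hq.
pose sub (B L : {set V}) := B \subset L.
pose s := enum [set B : {set V} | #|B| == j.-1].
pose E := enum [set L : {set V} | #|L| == j].
have [s' s's hs'] :=
  @alteration R {set V} {set V} sub q s E hq.
have sE : size s = 'C(#|V|, j.-1) by rewrite -card_draws cardE.
have -> : (1 - q) ^+ j * 'C(#|V|, j)%:R =
    \sum_(L <- E) (1 - q) ^+ count (sub^~ L) s.
  rewrite big_enum /= (eq_bigr (fun=> (1 - q) ^+ j)).
    by rewrite sumr_const card_draws mulr_natr.
  by move=> L; rewrite inE => /eqP cL; rewrite card_subsets_degree.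
rewrite -sE; apply: le_trans hs'; rewrite ler_nat.
pose un := [seq L <- E | ~~ has (sub^~ L) s'].
have hsub (L : {set V}) : #|L| = j -> exists B : {set V}, (B \subset L) && (#|B| == j.-1).
  move=> cL; have /card_gt0P[b bL] : (0 < #|L|)%N by rewrite cL.
  exists (L :\ b); rewrite finset.subsetDl /=.
  by rewrite -cL (cardsD1 b L) bL.
(* The extra (j-1)-set spent on an uncovered L; the default set0 is never used
   for L of cardinality j. *)
pose sb (L : {set V}) := odflt finset.set0 [pick B : {set V} | (B \subset L) && (#|B| == j.-1)].
have hsb (L : {set V}) : #|L| = j -> (sb L \subset L) && (#|sb L| == j.-1).
  move=> /hsub[B hB]; rewrite /sb; case: pickP => [//|/(_ B)].
  by rewrite hB.
apply: (@leq_trans #|[set B in s' ++ [seq sb L | L <- un]]|); last first.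
  rewrite cardsE (leq_trans (card_size _)) // size_cat size_map.
  by rewrite /un size_filter.
apply: D_le_subsets => // L cL.
have [/hasP[B Bs' BL]|nh] := boolP (has (sub^~ L) s').
  exists B; first by rewrite inE mem_cat Bs'.
  by split=> //; have := s's B Bs'; rewrite mem_enum inE => /eqP.
exists (sb L); last by have /andP[? /eqP] := hsb L cL.
rewrite inE mem_cat; apply/orP; right; apply/mapP; exists L => //.
by rewrite mem_filter nh mem_enum inE cL eqxx.
Qed.

(** With v = #|V|, a = v - j + 1, M = 'C(v, j-1) and N = 'C(v, j) one has
    M * a = j * N, so that q = ln a / j makes q * M = N * ln a / a, while
    (1 - q)^j <= e^(- q * j) = 1 / a.  This q is not a probability when ln a > j,
    but then taking all (j-1)-sets, that is q = 1, costs only M = N * j / a. *)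
Lemma D_le_log (j : nat) : (0 < j <= #|V|)%N ->
  (D V j)%:R <= (1 + ln ((#|V| - j + 1)%N%:R : R)) / (#|V| - j + 1)%N%:R
                * 'C(#|V|, j)%:R.
Proof.
move=> /andP[j0 jV].
set a : R := (#|V| - j + 1)%N%:R; set N : R := 'C(#|V|, j)%:R.
have a1 : 1 <= a by rewrite ler1n addn1.
have a0 : 0 < a by lra.
have J0 : 0 < j%:R :> R by rewrite ltr0n.
have eM : 'C(#|V|, j.-1)%:R = j%:R * N / a.
  apply: canRL (mulfK _) _; first by rewrite gt_eqF.
  rewrite /N /a -!natrM; congr (_%:R).
  case: (j) j0 jV => // i _ iV; rewrite mul_bin_left /= mulnC; congr (_ * _)%N.
  by rewrite addn1 subnSK.
have N0 : 0 <= N by rewrite ler0n.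
have la0 : 0 <= ln a by apply: ln_ge0.
have [laj|laj] := leP (ln a) j%:R.
- have q01 : 0 <= ln a / j%:R <= 1.
    by rewrite divr_ge0 ?ler0n //= ler_pdivrMr // mul1r.
  apply: le_trans (D_le_alteration j0 q01) _.
  have -> : (1 + ln a) / a * N = ln a / j%:R * 'C(#|V|, j.-1)%:R + a^-1 * N.
    by rewrite eM; field; rewrite !gt_eqF.
  rewrite lerD2l ler_wpM2r //.
  have -> : a^-1 = expR (- (ln a / j%:R)) ^+ j.
    rewrite -expRM_natr mulNr divfK ?gt_eqF //.
    by rewrite expRN lnK.
  case/andP: q01 => q0 q1.
  by rewrite lerXn2r ?nnegrE ?expR_ge0 ?subr_ge0 // expR_ge1Dx.
- have q01 : 0 <= (1 : R) <= 1 by rewrite ler01 lexx.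
  apply: le_trans (D_le_alteration j0 q01) _.
  rewrite subrr expr0n gtn_eqF // mul0r addr0 mul1r eM.
  rewrite mulrAC ler_wpM2r // ler_wpM2r ?invr_ge0 ?(ltW a0) //.
  by lra.
Qed.

(** The bounds 'C(v-1, j-1) sum to 2^(v-1) without the term j = 1. *)
Lemma U_le_pow : (1 <= #|V|)%N -> (U V #|V| <= 2 ^ (#|V| - 1) - 1)%N.
Proof.
move=> hV; rewrite /U.
apply: (@leq_trans (\sum_(2 <= j < #|V|.+1) 'C(#|V| - 1, j - 1))%N).
  rewrite !big_nat; apply: leq_sum => j /andP[j2 jV].
  by apply: D_le_bin; rewrite (ltn_trans _ j2).
case: #|V| hV => // n _; rewrite subn1 /=.
have := expnDn 1 1 n; rewrite add1n => ->.
rewrite -(big_mkord xpredT (fun i => 'C(n, i) * (1 ^ (n - i) * 1 ^ i))%N).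
rewrite [in leqRHS]big_ltn // bin0 !exp1n add1n subn1 /=.
rewrite [leqLHS]big_add1 /=; apply: leq_sum => i _.
by rewrite subn1 !exp1n !muln1.
Qed.

(** The summand j = v is at most 1.  For 2 <= j < v, bound ln (v - j + 1) by
    ln (v - 1) and use 'C(v, j) / (v - j + 1) = 'C(v+1, j) / (v + 1); the binomial
    coefficients 'C(v+1, j) with 2 <= j < v sum to 2^(v+1) - 2 - 2 * (v + 1). *)
Lemma U_le_log : (2 <= #|V|)%N ->
  (U V #|V|)%:R <= 2 * (ln (#|V|%:R - 1) + 1) / (#|V|%:R + 1)
        * (2 ^+ #|V| - (#|V|%:R + 1) - 1) + 1 :> R.
Proof.
move=> hV; set v := #|V|; set n : R := v%:R.
have n2 : 2 <= n by rewrite /n ler_nat.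
have D1 : (D V v <= 1)%N.
  by rewrite -[leqRHS](binn (v - 1)); apply: D_le_bin; rewrite leqnn andbT ltnW.
rewrite /U big_nat_recr //= natrD.
apply: lerD; last by rewrite lern1.
set K := 2 * _ / _ * _.
have -> : K = \sum_(2 <= j < v) (ln (n - 1) + 1) / (n + 1) * 'C(v.+1, j)%:R.
  rewrite -mulr_sumr /K.
  suff -> : \sum_(2 <= j < v) 'C(v.+1, j)%:R = 2 * (2 ^+ v - (n + 1) - 1) :> R.
    by field; rewrite gt_eqF //; lra.
  have : 2 ^+ v.+1 = \sum_(0 <= j < v.+2) 'C(v.+1, j)%:R :> R.
    rewrite -natrX -[2%N]/(1 + 1)%N expnDn natr_sum big_mkord.
    by apply: eq_bigr => i _; rewrite !exp1n !muln1.
  rewrite big_ltn // big_ltn //.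
  rewrite !big_nat_recr ?ltnS // /= ; last by rewrite ltnW.
  rewrite bin0 bin1 binn binSn -natr1 -/n exprS.
  by lra.
rewrite natr_sum; apply: ler_sum_nat => j /andP[j2 jv].
have jV : (0 < j <= v)%N by rewrite (ltn_trans _ j2) //= ltnW.
apply: le_trans (D_le_log jV) _; rewrite -/v.
set a : R := (v - j + 1)%N%:R.
have ea : a = n - j%:R + 1 by rewrite /a natrD natrB // ltnW.
have j2' : 2 <= j%:R :> R by rewrite ler_nat.
have jv' : j%:R <= n by rewrite ler_nat ltnW.
have a1 : 1 <= a by lra.
have eC : 'C(v, j)%:R = a / (n + 1) * 'C(v.+1, j)%:R.
  apply: (@mulfI _ (n + 1)); first by rewrite gt_eqF //; lra.
  rewrite mulrA [_ * (a / _)]mulrC divfK; last by rewrite gt_eqF //; lra.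
  rewrite /a /n natr1 -!natrM; congr (_%:R).
  by rewrite mul_bin_down addn1 subSn // ltnW.
rewrite eC mulrA ler_wpM2r //.
have -> : (1 + ln a) / a * (a / (n + 1)) = (1 + ln a) / (n + 1).
  by field; apply/andP; split; rewrite gt_eqF //; lra.
rewrite ler_wpM2r ?invr_ge0; [by []|lra|].
rewrite [leRHS]addrC lerD2l ler_ln ?posrE; lra.
Qed.

End Bounds.

(** * Universal approximation *)

Theorem corollary12 (R : realType) (V H : finType) (hV : (1 <= #|V|)%N) :
  [/\ (U V #|V| <= #|H|)%N ->
        forall p : {ffun state V -> R},
          is_distribution p -> approximable (@RBM R V H) p,
      forall j : nat, (0 < j <= #|V|)%N ->
        (D V j)%:R <= (1 + ln ((#|V| - j + 1)%N%:R : R)) / (#|V| - j + 1)%N%:R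
                      * 'C(#|V|, j)%:R
        /\ (D V j <= 'C(#|V| - 1, j - 1))%N,
      (2 ^ (#|V| - 1) - 1 <= #|H|)%N ->
        forall p : {ffun state V -> R},
          is_distribution p -> approximable (@RBM R V H) p
    & (2 <= #|V|)%N ->
      2 * (ln (#|V|%:R - 1) + 1) / (#|V|%:R + 1)
        * (2 ^+ #|V| - (#|V|%:R + 1) - 1) + 1 <= (#|H|%:R : R) ->
        forall p : {ffun state V -> R},
          is_distribution p -> approximable (@RBM R V H) p ].
Proof.
have universal : (U V #|V| <= #|H|)%N ->
    forall p : {ffun state V -> R}, is_distribution p -> approximable (@RBM R V H) p.
  move=> hU p; apply: RBM_approximable => f.
  exact: energy_approx_leq hU (energy_approx_all f hV).
split=> // [j hj|hH|hV2 hH].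
- by split; [apply: D_le_log | apply: D_le_bin].
- by apply: universal; apply: leq_trans (U_le_pow hV) hH.
- by apply: universal; rewrite -(ler_nat R); apply: le_trans (U_le_log hV2) hH.
Qed.
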